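(* Let $p$ be an odd prime, $m,s$ positive integers, and $\mathcal{R}=\mathbb{F}_{p^m}[u,v]/\langle u^2,v^2,uv-vu\rangle$. Let $\alpha=\alpha_1+\alpha_2u+\alpha_3v+\alpha_4uv\in\mathcal{R}$ with $\alpha_1,\alpha_2,\alpha_3\in\mathbb{F}_{p^m}^*$, $\alpha_4\in\mathbb{F}_{p^m}$, and suppose $\alpha$ is not a square in $\mathcal{R}$. Let $\alpha_0\in\mathbb{F}_{p^m}$ be the element with $\alpha_0^{p^s}=\alpha_1$. Let $\mathcal{C}=\langle u(x^2-\alpha_0)^\ell\rangle$ be the ideal of $\mathcal{R}_\alpha=\mathcal{R}[x]/\langle x^{2p^s}-\alpha\rangle$, where $0\le\ell\le 2p^s-1$. Then the Hamming distance of $\mathcal{C}$ is $$d_H(\mathcal{C})=\begin{cases}1 & \text{if } 0\le\ell\le p^s;\\ (\Gamma+1)p^{\gamma} & \text{if } 2p^s-p^{s-\gamma}+(\Gamma-1)p^{s-\gamma-1}+1\le\ell\le 2p^s-p^{s-\gamma}+\Gamma p^{s-\gamma-1},\\ & \text{where } 1\le\Gamma\le p-1 \text{ and } 0\le\gamma\le s-1.\end{cases}$$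
   Context: Elements of $\mathcal{R}_\alpha=\mathcal{R}[x]/\langle x^{2p^s}-\alpha\rangle$ are identified with vectors in $\mathcal{R}^{2p^s}$: the class whose representative of degree less than $2p^s$ is $\zeta_0+\zeta_1x+\cdots+\zeta_{2p^s-1}x^{2p^s-1}$ corresponds to $(\zeta_0,\ldots,\zeta_{2p^s-1})$. Ideals of $\mathcal{R}_\alpha$ are thereby the $\alpha$-constacyclic codes of length $2p^s$ over $\mathcal{R}$. The Hamming weight of a vector is the number of its nonzero entries, and the Hamming distance $d_H(\mathcal{C})$ of a nonzero linear code is the minimum Hamming weight of its nonzero codewords. *)

(* Defs.v *)
From mathcomp Require Import all_boot all_order all_algebra.

Set Implicit Arguments.
Unset Strict Implicit.
Unset Printing Implicit Defensive.

Import GRing.Theory.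
Local Open Scope ring_scope.

Definition X2 (A : comNzRingType) : {poly A} := 'X^2.

(* F[u,v]/<u^2, v^2, uv - vu> is built as the iterated quotient
   (F[u]/<u^2>)[v]/<v^2>; [Ruv_basis] below shows that it is free over F on
   1, u, v, uv, and [Ru_sqr], [Rv_sqr] give the defining relations. *)
Definition Ru_ring (F : fieldType) := {poly %/ X2 F}.

Definition Ruv (F : fieldType) := {poly %/ X2 (Ru_ring F)}.

Definition Rc (F : fieldType) (a : F) : Ruv F :=
  qpolyC (X2 (Ru_ring F)) (qpolyC (X2 F) a).

Definition Ru (F : fieldType) : Ruv F :=
  qpolyC (X2 (Ru_ring F)) (qpolyX (X2 F)).

Definition Rv (F : fieldType) : Ruv F := qpolyX (X2 (Ru_ring F)).

Arguments Ru {F}.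
Arguments Rv {F}.

Definition constacyclic_modulus (R : comNzRingType) (n : nat) (alpha : R) :
  {poly R} := 'X^n - alpha%:P.

Definition constacyclic_ring (R : comNzRingType) (n : nat) (alpha : R) :=
  {poly %/ constacyclic_modulus n alpha}.

Definition residue_class (R : comNzRingType) (n : nat) (alpha : R) (f : {poly R}) :
  constacyclic_ring n alpha := in_qpoly (constacyclic_modulus n alpha) f.

Definition principal_ideal (A : comNzRingType) (g : A) : A -> Prop :=
  fun c => exists a : A, c = a * g.

(* An element of {poly %/ h} is literally its reduced representative, so its
   coefficients are those of the representative of degree < n. *)
Definition word_of (R : comNzRingType) (n : nat) (alpha : R)
    (c : constacyclic_ring n alpha) : 'rV[R]_n :=
  \row_(i < n) (c : {poly R})`_i.

Definition code_of (R : comNzRingType) (n : nat) (alpha : R)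
    (I : constacyclic_ring n alpha -> Prop) : 'rV[R]_n -> Prop :=
  fun w => exists2 c, I c & w = word_of c.

Definition hamming_weight (R : comNzRingType) (n : nat) (w : 'rV[R]_n) : nat :=
  #|[set i : 'I_n | w 0 i != 0]|.

(* Fails for every d when C has no nonzero codeword. *)
Definition is_hamming_distance (R : comNzRingType) (n : nat)
    (C : 'rV[R]_n -> Prop) (d : nat) : Prop :=
  (exists w, [/\ C w, w != 0 & hamming_weight w = d]) /\
  (forall w, C w -> w != 0 -> (d <= hamming_weight w)%N).

Fact is_hamming_distance_uniq (R : comNzRingType) (n : nat)
    (C : 'rV[R]_n -> Prop) (d d' : nat) :
  is_hamming_distance C d -> is_hamming_distance C d' -> d = d'.
Proof.
move=> [[w [Cw w0 <-]] H] [[w' [Cw' w'0 <-]] H'].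
by apply/eqP; rewrite eqn_leq H ?H'.
Qed.

Fact constacyclic_modulusE (R : comNzRingType) (n : nat) (alpha : R) :
  (0 < n)%N ->
  mk_monic (constacyclic_modulus n alpha) = 'X^n - alpha%:P.
Proof.
move=> n0; rewrite /mk_monic /constacyclic_modulus size_XnsubC //.
by rewrite monicXnsubC // ltnS n0.
Qed.

Fact sq_qpolyX (A : comNzRingType) :
  qpolyX (X2 A) * qpolyX (X2 A) = 0.
Proof.
rewrite /qpolyX -in_qpolyM -expr2; apply/val_inj => /=.
by rewrite /X2 mk_monic_Xn Pdiv.RingMonic.rmodpp // monicXn.
Qed.

Fact Ru_sqr (F : fieldType) : (Ru : Ruv F) ^+ 2 = 0.
Proof.
rewrite expr2; apply: etrans (esym (qpolyCM _ _ _)) _.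
by rewrite sq_qpolyX qpolyC0.
Qed.

Fact Rv_sqr (F : fieldType) : (Rv : Ruv F) ^+ 2 = 0.
Proof. by rewrite expr2; apply: sq_qpolyX. Qed.

Fact qpolyX2_basis (A : comNzRingType) (z : {poly %/ X2 A}) :
  exists! ab : A * A, z = qpolyC _ ab.1 + qpolyC _ ab.2 * qpolyX _.
Proof.
have E (a b : A) : (qpolyC (X2 A) a + qpolyC (X2 A) b * qpolyX (X2 A)
    : {poly %/ X2 A}) = a%:P + b%:P * 'X :> {poly A}.
  rewrite poly_of_qpolyD poly_of_qpolyM !qpolyCE qpolyXE /X2 ?monicXn ?size_polyXn //.
  rewrite mk_monic_Xn Pdiv.CommonRing.rmodp_small // size_polyXn ltnS mul_polyC.
  by rewrite (leq_trans (size_scale_leq _ _)) // size_polyX.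
exists ((z : {poly A})`_0, (z : {poly A})`_1); split=> [|[a b] zE].
  apply/val_inj; apply: etrans (esym (E _ _)); apply/polyP=> -[|[|i]];
    rewrite coefD coefC coefCM coefX /= ?mulr0 ?mulr1 ?addr0 ?add0r //.
  by rewrite nth_default // (leq_trans (size_npoly z)) // /X2 mk_monic_Xn size_polyXn.
have {}zE : z = a%:P + b%:P * 'X :> {poly A} by rewrite zE; apply: E.
by rewrite zE; congr pair; rewrite coefD coefC coefCM coefX /= ?mulr0 ?mulr1 ?addr0 ?add0r.
Qed.

Fact Ruv_basis (F : fieldType) (z : Ruv F) :
  exists! a : F * F * (F * F),
    z = Rc a.1.1 + Rc a.1.2 * Ru + Rc a.2.1 * Rv + Rc a.2.2 * (Ru * Rv).
Proof.
have H (x y t w : F) : Rc x + Rc y * Ru + Rc t * Rv + Rc w * (Ru * Rv)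
  = qpolyC (X2 (Ru_ring F))
      (qpolyC (X2 F) x + qpolyC (X2 F) y * qpolyX (X2 F) : Ru_ring F)
  + qpolyC (X2 (Ru_ring F))
      (qpolyC (X2 F) t + qpolyC (X2 F) w * qpolyX (X2 F) : Ru_ring F)
    * qpolyX _.
  by rewrite !qpolyCD !qpolyCM mulrDl -!addrA mulrA.
have [[z0 z1] [/= zE zU]] := qpolyX2_basis z.
have [[x y] [/= z0E z0U]] := qpolyX2_basis z0.
have [[t w] [/= z1E z1U]] := qpolyX2_basis z1.
exists (x, y, (t, w)); split=> [|[[x' y'] [t' w']] /=]; first by rewrite /= H -z0E -z1E.
rewrite H => /(zU (_, _)) [e0 e1].
by have [-> ->] := z0U (_, _) e0; have [-> ->] := z1U (_, _) e1.
Qed.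

(* Main.v *)
From HB Require Import structures.
Require Import Defs.
From mathcomp Require Import all_boot all_order all_algebra all_field.
From mathcomp Require Import zify ring.
Set Implicit Arguments.
Unset Strict Implicit.
Unset Printing Implicit Defensive.
Import GRing.Theory.
Local Open Scope ring_scope.

(* In the quotient, (x^2 - a0)^(p^s) = alpha - a1, so u (x^2 - a0)^(p^s) = a3 uv:
   if l <= p^s the code contains uv, and if l = p^s + k it is uv times the code
   generated by (x^2 - a0)^k in F[x]/(x^2 - a0)^(p^s), with the same weights.
   Splitting a polynomial into its even and odd parts turns x^2 - a0 into
   x - a0. The lower bound is then the theorem of Massey, Costello and Justesen:
   in characteristic p a polynomial vanishing to order exactly t at a nonzero
   point has at least prod (t_i + 1) nonzero coefficients, where the t_i are the
   base p digits of t. The power of x^2 - a0 whose exponent is the upper end of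
   the range of k attains it. *)

(** * Number of nonzero coefficients, and splitting by exponents modulo [n] *)

Section PolyWeight.
Variable F : fieldType.
Implicit Types f g h : {poly F}.

Definition poly_weight f : nat := (\sum_(i < size f) (f`_i != 0)%R)%N.
Notation wt := poly_weight.

Lemma poly_weightE n f : (size f <= n)%N -> wt f = (\sum_(i < n) (f`_i != 0)%R)%N.
Proof.
move=> le_n; rewrite /poly_weight -!(big_mkord xpredT (fun i => (f`_i != 0)%R : nat)).
rewrite (big_cat_nat (leq0n _) le_n) /= -[LHS]addn0; congr addn.
rewrite big_nat_cond big1 // => i /andP[/andP[le_i _] _].
by rewrite nth_default ?eqxx.
Qed.

Lemma poly_weight_gt0 f : f != 0 -> (0 < wt f)%N.
Proof.
move=> f0; rewrite (poly_weightE (leqSpred _)) big_ord_recr /=.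
by rewrite -lead_coefE lead_coef_eq0 f0 addn1.
Qed.

Lemma leq_poly_weight_size f : (wt f <= size f)%N.
Proof.
by rewrite -[leqRHS]card_ord -sum1_card; apply: leq_sum => i _; case: (_ != _).
Qed.

Lemma poly_weightD f g : (wt (f + g)%R <= wt f + wt g)%N.
Proof.
pose n := maxn (size f) (size g).
rewrite (poly_weightE (size_polyD f g)) (@poly_weightE n f) ?leq_maxl //.
rewrite (@poly_weightE n g) ?leq_maxr // -big_split leq_sum //= => i _.
rewrite coefD; case: eqP => //= fg0.
have [f0|//] := eqVneq f`_i 0; have [g0|//] := eqVneq g`_i 0.
by rewrite f0 g0 addr0 in fg0.
Qed.

Lemma poly_weight_sum I (r : seq I) (A : I -> {poly F}) :
  (wt (\sum_(i <- r) A i)%R <= \sum_(i <- r) wt (A i))%N.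
Proof.
elim: r => [|i r IH]; first by rewrite !big_nil (leq_trans (leq_poly_weight_size _)) ?size_poly0.
by rewrite !big_cons (leq_trans (poly_weightD _ _)) // leq_add2l.
Qed.

Lemma poly_weight_scale_Xn a j f : (wt (a *: ('X^j * f)) <= wt f)%N.
Proof.
have sz : (size (a *: ('X^j * f)) <= j + size f)%N.
  rewrite (leq_trans (size_scale_leq _ _)) // (leq_trans (size_polyMleq _ _)) //.
  by rewrite size_polyXn.
rewrite (poly_weightE sz) big_split_ord /= big1 ?add0n; last first.
  by move=> i _; rewrite coefZ coefXnM ltn_ord mulr0 eqxx.
apply: leq_sum => i _; rewrite coefZ coefXnM ltnNge leq_addr addKn /=.
by rewrite mulf_eq0 negb_or; case: (f`_i != 0); rewrite ?andbF // andbT leq_b1.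
Qed.

(** The binomial theorem gives [n + 1] terms, each a scaled shift of [f]. *)
Lemma poly_weight_binomial_exp q b n f :
  (wt (('X^q - b%:P) ^+ n * f) <= n.+1 * wt f)%N.
Proof.
have -> : ('X^q - b%:P) ^+ n * f = \sum_(i < n.+1)
    ((- b) ^+ i *+ 'C(n, i)) *: ('X^(q * (n - i)) * f).
  rewrite -polyCN exprDn mulr_suml; apply: eq_bigr => i _.
  by rewrite -exprM -polyC_exp -mul_polyC polyCMn !mulrnAl mulrCA mulrA.
apply: leq_trans (poly_weight_sum _ _) _.
rewrite -[X in (_ <= X * _)%N](card_ord n.+1) -sum_nat_const.
by apply: leq_sum => i _; apply: poly_weight_scale_Xn.
Qed.

(** For [i < n] these are the [f_i] in [f = sum X^i f_i(X^n)]. The bound [size f] is crude but loses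
    nothing when [n > 0], since [j * n + i >= j]. *)
Definition poly_component n i f : {poly F} := \poly_(j < size f) f`_(j * n + i).

Lemma coef_poly_component n i f j :
  (0 < n)%N -> (poly_component n i f)`_j = f`_(j * n + i).
Proof.
move=> n0; rewrite coef_poly; case: ltnP => // lt_j.
by rewrite nth_default // (leq_trans lt_j) // (leq_trans (leq_pmulr _ n0)) ?leq_addr.
Qed.

Lemma poly_weight_component n f :
  (0 < n)%N -> wt f = (\sum_(i < n) wt (poly_component n i f))%N.
Proof.
move=> n0; rewrite (poly_weightE (leq_pmulr (size f) n0)).
rewrite -(big_mkord xpredT (fun i => (f`_i != 0)%R : nat)) big_nat_mul.
under [RHS]eq_bigr => i _ do rewrite (poly_weightE (size_poly _ _)).
rewrite exchange_big big_mkord; apply: eq_bigr => j _ /=.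
rewrite -{1}[(j * n)%N]add0n big_addn mulSn addnK big_mkord.
by apply: eq_bigr => i _; rewrite coef_poly_component // addnC.
Qed.

Lemma poly_component_neq0 n f : (0 < n)%N -> f != 0 ->
  exists i : 'I_n, poly_component n i f != 0.
Proof.
move=> n0 /poly_weight_gt0; rewrite (poly_weight_component f n0).
rewrite lt0n sum_nat_eq0 negb_forall => /existsP[i /= wi].
exists i; apply: contraNneq wi => ->.
by rewrite -leqn0 (leq_trans (leq_poly_weight_size _)) ?size_poly0.
Qed.

Lemma size_poly_component n m i f :
  (0 < n)%N -> (size f <= m * n)%N -> (size (poly_component n i f) <= m)%N.
Proof.
move=> n0 szf; apply/leq_sizeP => j le_j; rewrite coef_poly_component //.
by rewrite nth_default // (leq_trans szf) // (leq_trans _ (leq_addr _ _)) // leq_mul2r le_j orbT.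
Qed.

(** The splitting is linear over [F[X^n]], with [X^n] acting on each component as [X]. *)
Lemma poly_component_mul n i d k f : (i < n)%N ->
  poly_component n i (('X^n - d%:P) ^+ k * f)
    = ('X - d%:P) ^+ k * poly_component n i f.
Proof.
move=> lt_i; have n0 : (0 < n)%N by case: n lt_i.
elim: k => [|k IH]; first by rewrite !expr0 !mul1r.
rewrite !exprS -!mulrA -IH; apply/polyP => j.
rewrite coef_poly_component // !mulrBl !coefB coefXnM coefXM !coefCM.
rewrite !coef_poly_component //; congr (_ - _).
case: j => [|j]; first by rewrite mul0n add0n lt_i.
by rewrite mulSn -addnA ltnNge leq_addr /= addKn.
Qed.

Lemma poly_component_recompose n f : (0 < n)%N ->
  f = \sum_(i < n) 'X^i * (poly_component n i f \Po 'X^n).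
Proof.
move=> n0; apply/polyP => k; rewrite coef_sum.
rewrite (bigD1 (Ordinal (ltn_pmod k n0))) //= coefXnM ltnNge leq_mod /=.
have Ek : (k - k %% n = k %/ n * n)%N by rewrite {1}(divn_eq k n) addnK.
rewrite coef_comp_poly_Xn // Ek dvdn_mull // mulnK // coef_poly_component //.
rewrite -divn_eq big1 ?addr0 // => i ne_i; rewrite coefXnM.
case: ltnP => // le_i; rewrite coef_comp_poly_Xn //.
case: ifP => // dv; case/eqP: ne_i; apply/val_inj => /=.
by rewrite -[in RHS](subnK le_i) -modnDml (eqP dv) add0n modn_small.
Qed.

End PolyWeight.
Notation wt := poly_weight.

Lemma expr_XnsubC_pchar (F : fieldType) p (charFp : p \in [pchar F]) (c : F) n e :
  ('X^n - c%:P) ^+ (p ^ e) = 'X^(n * p ^ e) - (c ^+ (p ^ e))%:P.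
Proof.
have charP : p \in [pchar {poly F}] by rewrite pchar_poly.
elim: e => [|e IH]; first by rewrite !expr1 muln1.
rewrite expnSr exprM IH -(pFrobenius_autE charP) pFrobenius_autB_comm; last exact: mulrC.
by rewrite !pFrobenius_autE -exprM mulnA -polyC_exp -exprM.
Qed.

(** * Products of incremented base [p] digits *)

Section DigitWeight.
Variable p : nat.
Hypothesis p_gt1 : (1 < p)%N.

Let p_gt0 : (0 < p)%N. Proof. exact: ltnW. Qed.

(** Only the [s] lowest digits count. For [p] prime and [t < p ^ s] this is, by Lucas, the number of
    [j] with [C(t, j)] nonzero modulo [p]. *)
Fixpoint digit_weight s t : nat :=
  if s is s'.+1 then ((t %% p).+1 * digit_weight s' (t %/ p))%N else 1%N.

Lemma digit_weight_drop a b t :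
  (digit_weight b (t %/ p ^ a) <= digit_weight (a + b) t)%N.
Proof.
elim: a t => [|a IH] t; first by rewrite divn1.
by rewrite expnS divnMA addSn /= (leq_trans (IH _)) // leq_pmull.
Qed.

(** One of the [a] lowest digits is nonzero, and its factor is at least 2. *)
Lemma digit_weight_drop_neq0 a b t : (t %% p ^ a != 0)%N ->
  (2 * digit_weight b (t %/ p ^ a) <= digit_weight (a + b) t)%N.
Proof.
elim: a t => [|a IH] t; first by rewrite modn1.
rewrite expnS divnMA addSn /= => nz.
have [t0|t_gt0] := posnP (t %% p); last first.
  by rewrite leq_mul ?digit_weight_drop.
rewrite t0 mul1n IH //; apply: contraNneq nz => t1.
by rewrite (divn_eq t p) t0 addn0 [(p * _)%N]mulnC -muln_modl t1.
Qed.

Lemma digit_weight_pred_exp b : digit_weight b (p ^ b).-1 = (p ^ b)%N.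
Proof.
elim: b => //= b IH.
have -> : (p ^ b.+1).-1 = ((p ^ b).-1 * p + p.-1)%N.
  by rewrite expnS; have := expn_gt0 p b; nia.
rewrite modnMDl divnMDl // modn_small ?divn_small ?addn0 ?prednK //.
by rewrite IH expnS.
Qed.

(** Such a [t] has its [b] upper digits equal to [p - 1] and its lowest digit at least [e]. *)
Lemma digit_weight_last b e t : (p ^ b.+1 - p + e <= t < p ^ b.+1)%N ->
  (e.+1 * p ^ b <= digit_weight b.+1 t)%N.
Proof.
move=> /andP[le_t lt_t]; have pb_gt0 : (0 < p ^ b)%N by rewrite expn_gt0 p_gt0.
have [e' tE lt_e'] : exists2 e', t = ((p ^ b).-1 * p + e')%N & (e <= e' < p)%N.
  by exists (t - (p ^ b).-1 * p)%N; rewrite expnS in le_t lt_t; nia.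
rewrite /= tE modnMDl divnMDl // modn_small ?divn_small ?addn0; try lia.
by rewrite digit_weight_pred_exp leq_mul2r; lia.
Qed.

(** Removing the [a = s - b - 1] lowest digits leaves [T >= p^(b+1) - p + G - 1]. If this is strict,
    the digits of [T] suffice. If it is an equality, they only give [G * p ^ b], but the strict
    lower bound on [t] forces a nonzero removed digit, which doubles this, and [2 G >= G + 1]. *)
Lemma digit_weight_range s b G t : (b < s)%N -> (0 < G < p)%N ->
  (p ^ s - p ^ (s - b) + (G - 1) * p ^ (s - b - 1) < t < p ^ s)%N ->
  (G.+1 * p ^ b <= digit_weight s t)%N.
Proof.
move=> lt_b G_range; pose a := (s - b - 1)%N.
have -> : s = (a + b.+1)%N by lia.
have -> : (a + b.+1 - b - 1 = a)%N by lia.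
have -> : (a + b.+1 - b = a.+1)%N by lia.
rewrite expnD [(p ^ a.+1)%N]expnS mulnC -mulnBl -mulnDl.
set q := (p ^ a)%N; have q_gt0 : (0 < q)%N by rewrite expn_gt0 p_gt0.
move=> /andP[lt_t]; rewrite -ltn_divLR // => lt_T.
have le_T : (p ^ b.+1 - p + (G - 1) <= t %/ q)%N by rewrite leq_divRL // ltnW.
have [T_eq|T_gt] := eqVneq (t %/ q)%N (p ^ b.+1 - p + (G - 1))%N.
  have rem_nz : (t %% q != 0)%N.
    by apply: contraTneq lt_t => r0; rewrite -T_eq {2}(divn_eq t q) r0 addn0 ltnn.
  apply: leq_trans (digit_weight_drop_neq0 _ rem_nz).
  have /digit_weight_last le_w : (p ^ b.+1 - p + (G - 1) <= t %/ q < p ^ b.+1)%N by rewrite le_T.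
  by apply: leq_trans (leq_mul (leqnn 2) le_w); rewrite mulnA leq_mul2r; lia.
apply: leq_trans (digit_weight_drop _ _ _).
by apply: digit_weight_last; rewrite -/q; lia.
Qed.

End DigitWeight.

(** * Weight and order of vanishing in characteristic [p] *)

Section MultiplicityBound.
Variables (F : fieldType) (p : nat).
Hypothesis charFp : p \in [pchar F].
Implicit Types f g h : {poly F}.

Let p_gt0 : (0 < p)%N. Proof. exact/prime_gt0/(pcharf_prime charFp). Qed.

Lemma natr_eq_pchar i j :
  (i < p)%N -> (j < p)%N -> (i%:R == j%:R :> F) = (i == j).
Proof.
wlog le_ji : i j / (j <= i)%N => [hw|] lt_i lt_j.
  have [/hw->//|/ltnW/hw Eji] := leqP j i.
  by rewrite eq_sym Eji // eq_sym.
rewrite -subr_eq0 -natrB // -(dvdn_pcharf charFp) -eqn_mod_dvd //.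
by rewrite !modn_small.
Qed.

(* The operator [f |-> X f' - j f] kills the coefficient of index [j] and, below
   degree [p], no other one; it lowers the order of vanishing by at most one. *)
Lemma poly_weight_small_degree t c f : c != 0 -> f != 0 -> (size f <= p)%N ->
  (('X - c%:P) ^+ t %| f)%R -> (t < wt f)%N.
Proof.
move=> c0; elim: t f => [|t IH] f f0 szf; first by rewrite poly_weight_gt0.
move=> /dvdpP[g fE].
have [j fj0] : exists j : 'I_p, f`_j != 0.
  have szf0 : (0 < size f)%N by rewrite size_poly_gt0.
  have lt_p : ((size f).-1 < p)%N by rewrite prednK.
  by exists (Ordinal lt_p); rewrite /= -lead_coefE lead_coef_eq0.
pose h := 'X * f^`() - j%:R *: f.
have hE i : h`_i = f`_i *+ i - f`_i *+ j.
  rewrite coefB coefXM coefZ mulr_natl; case: i => [|i] //=.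
  by rewrite coef_deriv.
have h_nz i : (h`_i != 0) = (i != j) && (f`_i != 0).
  rewrite hE -mulr_natr -[X in _ - X]mulr_natr -mulrBr mulf_eq0 negb_or andbC.
  have [_|fi0] := eqVneq f`_i 0; rewrite ?andbF // ?andbT.
  have lt_i : (i < p)%N.
    by rewrite ltnNge; apply: contraNN fi0 => le_p; rewrite nth_default // (leq_trans szf).
  by rewrite subr_eq0 natr_eq_pchar.
have szh : (size h <= p)%N.
  apply/leq_sizeP => i le_i; apply/eqP; apply: contraTT isT; rewrite h_nz.
  by rewrite (nth_default _ (leq_trans szf le_i)) eqxx andbF.
have wfE : wt f = (wt h).+1.
  rewrite (poly_weightE szf) (poly_weightE szh) (bigD1 j) //= fj0 add1n.
  rewrite [in RHS](bigD1 j) //= h_nz eqxx add0n.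
  by congr _.+1; apply: eq_bigr => i ne; rewrite h_nz ne.
rewrite wfE ltnS; apply: IH => //.
  (* If [h = 0], then [f] is a monomial, which cannot vanish at [c != 0]. *)
  apply: contraNneq fj0 => h0.
  have f1 : f = f`_j *: 'X^j.
    apply/polyP => i; rewrite coefZ coefXn.
    have := h_nz i; rewrite h0 coef0 eqxx.
    have [->|ne] := eqVneq i j; first by rewrite mulr1.
    by move=> /esym/negbFE/eqP->; rewrite mulr0.
  have : f.[c] == 0 by rewrite fE hornerM horner_exp hornerXsubC subrr expr0n mulr0.
  by rewrite f1 hornerZ hornerXn mulf_eq0 expf_eq0 (negPf c0) andbF orbF -f1.
have dvd_exp k : ('X - c%:P) ^+ t %| k * ('X - c%:P) ^+ t.+1.
  by rewrite exprSr mulrCA dvdp_mulr.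
rewrite /h; rewrite dvdp_subl; last by rewrite -mul_polyC dvdp_mull ?fE.
rewrite dvdp_mull // fE derivM deriv_exp derivXsubC mul1r /=.
by rewrite dvdp_addr // dvdp_mull // -mulr_natl dvdp_mull.
Qed.

(* Massey, Costello and Justesen: modulo [(X - c)^p = X^p - c^p] the cofactor
   [f / (X - c)^(p t1)] becomes a polynomial of degree less than [p] vanishing
   to order [t0] at [c], so at least [t0 + 1] of the [p] components of [f]
   vanish to order exactly [t1] at [c^p]. *)
Lemma digit_weight_le s t c g : c != 0 -> ~~ root g c ->
  (digit_weight p s t <= wt (('X - c%:P) ^+ t * g)%R)%N.
Proof.
elim: s t c g => [|s IH] t c g c0 gc0 /=.
  rewrite poly_weight_gt0 // mulf_neq0 ?expf_neq0 ?polyXsubC_eq0 //.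
  by apply: contraNneq gc0 => ->; rewrite root0.
set t0 := (t %% p)%N; set t1 := (t %/ p)%N.
pose d := c ^+ p; have d0 : d != 0 by rewrite expf_neq0.
have XcE : ('X - c%:P) ^+ p = 'X^p - d%:P.
  by have := expr_XnsubC_pchar charFp c 1 1; rewrite expn1 mul1n.
pose h := ('X - c%:P) ^+ t0 * g.
have fE : ('X - c%:P) ^+ t * g = ('X^p - d%:P) ^+ t1 * h.
  by rewrite {1}(divn_eq t p) exprD mulnC exprM XcE mulrA.
(* The remainder of [h] modulo [X^p - d]: replacing [X^p] by [d] evaluates each component at [d]. A
   nonzero coefficient of [r] thus marks a component without the root [d]. *)
pose r := \poly_(i < p) (poly_component p i h).[d].
have dvd_hr : ('X - c%:P) ^+ p %| h - r.
  rewrite XcE {1}(poly_component_recompose h p_gt0) /r poly_def -sumrB.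
  apply: (big_ind (fun q => 'X^p - d%:P %| q)) => [|q1 q2|i _].
  - exact: dvdp0.
  - exact: dvdp_add.
  rewrite -mul_polyC mulrC -mulrBl dvdp_mulr //.
  have -> : 'X^p - d%:P = ('X - d%:P) \Po 'X^p by rewrite comp_polyB comp_polyX comp_polyC.
  rewrite -(comp_polyC _.[d] 'X^p) -comp_polyB dvdp_comp_poly //.
  by rewrite dvdp_XsubCl rootE hornerD hornerN hornerC subrr.
have t0_lt : (t0 < p)%N by rewrite ltn_mod.
have r0 : r != 0.
  (* If [r = 0], then [(X - c)^p] divides [(X - c)^t0 * g] with [t0 < p], so [c] is a root of
     [g]. *)
  apply: contraNneq gc0 => r0; move: dvd_hr; rewrite r0 subr0 /h.
  rewrite -(subnKC t0_lt) exprD exprSr -mulrA dvdp_mul2l ?expf_neq0 ?polyXsubC_eq0 //.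
  by move=> dvd; rewrite -dvdp_XsubCl (dvdp_trans _ dvd) // dvdp_mulr.
have dvd_r : ('X - c%:P) ^+ t0 %| r.
  have -> : r = h - (h - r) by rewrite opprB addrC subrK.
  by rewrite dvdp_sub ?dvdp_mulr // (dvdp_trans _ dvd_hr) // dvdp_exp2l // ltnW.
have le_r : (t0.+1 * digit_weight p s t1 <= wt r * digit_weight p s t1)%N.
  by rewrite leq_mul2r (poly_weight_small_degree c0 r0 (size_poly _ _) dvd_r) orbT.
apply: leq_trans le_r _.
(* Both sides are compared component by component: a zero coefficient of [r] requires nothing, a
   nonzero one lets induction apply with root [d] and exponent [t1]. *)
rewrite (poly_weightE (size_poly _ _)) (poly_weight_component _ p_gt0) big_distrl.
apply: leq_sum => i _ /=; rewrite coef_poly ltn_ord fE poly_component_mul //.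
by case: eqP => //= /eqP hi; rewrite mul1n IH.
Qed.

End MultiplicityBound.

(** * Weight of multiples and of powers of [X^n - c] *)

Section PowerDivisible.
Variables (F : fieldType) (p : nat).
Hypothesis charFp : p \in [pchar F].
Variables (c : F) (s b G k : nat).
Hypotheses (c0 : c != 0) (lt_b : (b < s)%N) (G_range : (0 < G < p)%N).
Hypothesis k_gt : (p ^ s - p ^ (s - b) + (G - 1) * p ^ (s - b - 1) < k)%N.

(** The exact order [t] of [f] at [c] is at least [k] by divisibility and below [p ^ s] by degree,
    so [digit_weight_range] controls its digits. *)
Lemma poly_weight_dvd_XsubC_exp (f : {poly F}) :
  f != 0 -> (size f <= p ^ s)%N -> ('X - c%:P) ^+ k %| f ->
  (G.+1 * p ^ b <= wt f)%N.
Proof.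
move=> f0 szf dvd; have [t [g]] := multiplicity_XsubC f c.
rewrite f0 /= => gc0 fE; have g0 : g != 0 by apply: contraNneq gc0 => ->; rewrite root0.
have le_k : (k <= t)%N.
  rewrite leqNgt; apply: contraNN gc0 => lt_t; move: dvd.
  rewrite fE -(subnKC lt_t) exprD exprSr -mulrA mulrC dvdp_mul2r ?expf_neq0 ?polyXsubC_eq0 //.
  by move=> dvd; rewrite -dvdp_XsubCl (dvdp_trans _ dvd) // dvdp_mulr.
have lt_t : (t < p ^ s)%N.
  apply: leq_trans szf; rewrite fE size_Mmonic // ?monic_exp ?monicXsubC //.
  by rewrite size_exp_XsubC addnS /= -[ltnLHS]add0n ltn_add2r size_poly_gt0.
rewrite fE mulrC (leq_trans _ (digit_weight_le charFp s _ c0 gc0)) //.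
apply: (digit_weight_range (prime_gt1 (pcharf_prime charFp)) lt_b) => //.
by rewrite lt_t (leq_trans k_gt).
Qed.

(** Every component inherits divisibility by [(X - c)^k] and has size at most [p ^ s]; a single
    nonzero one already has enough coefficients. *)
Lemma poly_weight_dvd_XnsubC_exp n (f : {poly F}) : (0 < n)%N ->
  f != 0 -> (size f <= n * p ^ s)%N -> ('X^n - c%:P) ^+ k %| f ->
  (G.+1 * p ^ b <= wt f)%N.
Proof.
move=> n0 f0 szf /dvdpP[q fE].
have [i fi0] := poly_component_neq0 n0 f0.
rewrite (poly_weight_component f n0) (bigD1 i) //= (leq_trans _ (leq_addr _ _)) //.
apply: poly_weight_dvd_XsubC_exp => //.
  by rewrite size_poly_component // mulnC.
by rewrite fE mulrC poly_component_mul // dvdp_mulr.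
Qed.

End PowerDivisible.

(* [p ^ s - p ^ (s - b) + G p ^ (s - b - 1)] has base [p] digits
   [p - 1] ([b] times), [G], then zeros. *)
Lemma poly_weight_XnsubC_exp (F : fieldType) p (charFp : p \in [pchar F])
    (c : F) n s b G : (b < s)%N ->
  (wt (('X^n - c%:P) ^+ (p ^ s - p ^ (s - b) + G * p ^ (s - b - 1)))
    <= G.+1 * p ^ b)%N.
Proof.
move=> lt_b; have p_gt0 := prime_gt0 (pcharf_prime charFp).
pose a := (s - b - 1)%N; have -> : (s - b - 1 = a)%N by [].
have -> : (s - b = a.+1)%N by rewrite /a; lia.
have -> : (p ^ s - p ^ a.+1 + G * p ^ a = p ^ a * G + p ^ a.+1 * (p ^ b).-1)%N.
  have -> : s = (a.+1 + b)%N by rewrite /a; lia.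
  by rewrite expnD -subn1 mulnBr muln1 addnC mulnC.
(* Frobenius leaves the [G]-th power of one binomial times the [(p^b - 1)]-th power of another, with
   at most [(G + 1) p^b] terms in the expansion. *)
rewrite exprD !exprM !(expr_XnsubC_pchar charFp) (leq_trans (poly_weight_binomial_exp _ _ _ _)) //.
rewrite leq_mul2l -[X in wt X]mulr1 (leq_trans (poly_weight_binomial_exp _ _ _ _)) ?orbT //.
rewrite prednK ?expn_gt0 ?p_gt0 // (leq_trans (leq_mul (leqnn _) (leq_poly_weight_size _))) //.
by rewrite size_poly1 muln1.
Qed.

(** * Constacyclic codes over an [F]-algebra spanned by [1, u, v, uv] *)

Lemma hamming_weight_eq0 (R : comNzRingType) n (w : 'rV[R]_n) :
  (hamming_weight w == 0%N) = (w == 0).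
Proof.
rewrite cards_eq0; apply/eqP/eqP => [/setP w0|->]; last first.
  by apply/setP => i; rewrite !inE mxE eqxx.
by apply/rowP => i; move: (w0 i); rewrite !inE mxE => /negbFE/eqP.
Qed.

Section FreeOverField.
Variables (F : fieldType) (R : comNzRingType) (c : {rmorphism F -> R}) (u v : R).
Hypotheses (u_sqr : u ^+ 2 = 0) (v_sqr : v ^+ 2 = 0).
Hypothesis span_uv : forall z : R, exists a : F * F * (F * F),
  z = c a.1.1 + c a.1.2 * u + c a.2.1 * v + c a.2.2 * (u * v).
Hypothesis free_uv : forall a, c a * (u * v) = 0 -> a = 0.

Lemma mul_u_span (a b d e : R) :
  u * (a + b * u + d * v + e * (u * v)) = a * u + d * (u * v).
Proof.
have -> : u * (a + b * u + d * v + e * (u * v))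
  = a * u + d * (u * v) + u ^+ 2 * (b + e * v) by ring.
by rewrite u_sqr mul0r addr0.
Qed.

Lemma mul_uv_span (a b d e : R) :
  u * v * (a + b * u + d * v + e * (u * v)) = a * (u * v).
Proof.
rewrite mulrAC mul_u_span mulrDl.
have -> : d * (u * v) * v = d * u * v ^+ 2 by ring.
by rewrite v_sqr mulr0 addr0 mulrA.
Qed.

(** Both [u] and [v] annihilate [uv], so the ideal it generates is the line [F uv]. *)
Lemma mul_uv z : exists a, u * v * z = c a * (u * v).
Proof. by have [a ->] := span_uv z; exists a.1.1; apply: mul_uv_span. Qed.

Lemma mul_uv_eq0 a : (c a * (u * v) == 0) = (a == 0).
Proof. by apply/eqP/eqP => [/free_uv//|->]; rewrite rmorph0 mul0r. Qed.

(** Embeds [F[X]] into [R[X]] as [uv F[X]]. No nonzero scalar kills [uv], so weights are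
    preserved. *)
Definition uv_poly (f : {poly F}) : {poly R} := (u * v) *: map_poly c f.

Lemma coef_uv_poly f i : (uv_poly f)`_i = c f`_i * (u * v).
Proof. by rewrite coefZ coef_map mulrC. Qed.

Lemma size_uv_poly f : (size (uv_poly f) <= size f)%N.
Proof. by rewrite (leq_trans (size_scale_leq _ _)) // size_poly. Qed.

Lemma uv_polyD f g : uv_poly (f + g) = uv_poly f + uv_poly g.
Proof. by rewrite /uv_poly rmorphD scalerDr. Qed.

Lemma uv_polyM f g : uv_poly (f * g) = map_poly c f * uv_poly g.
Proof. by rewrite /uv_poly rmorphM scalerAr. Qed.

Lemma map_XnsubC k a : map_poly c ('X^k - a%:P) = 'X^k - (c a)%:P.
Proof. by rewrite rmorphB /= map_polyXn map_polyC. Qed.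

(** [uv F[X]] is an ideal of [R[X]]; [g] is built from [A] coefficient by coefficient with
    [mul_uv]. *)
Lemma mul_uv_poly (A : {poly R}) f : exists g, A * uv_poly f = uv_poly (g * f).
Proof.
suff [g gE] : exists g, (u * v) *: A = uv_poly g.
  by exists g; rewrite uv_polyM /uv_poly -!scalerAr !scalerAl gE.
elim/poly_ind: A => [|A z [g gE]]; first by exists 0; rewrite /uv_poly rmorph0 !scaler0.
have [a zE] := mul_uv z.
exists (g * 'X + a%:P); rewrite uv_polyD scalerDr; congr (_ + _).
  by rewrite [g * _]mulrC uv_polyM map_polyX -gE -scalerAr [_ * 'X]mulrC.
by rewrite /uv_poly map_polyC -!mul_polyC -!polyCM zE mulrC.
Qed.

Lemma hamming_weight_uv_poly n (w : 'rV[R]_n) (f : {poly F}) : (size f <= n)%N ->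
  (forall i, w 0 i = (uv_poly f)`_i) -> hamming_weight w = wt f.
Proof.
move=> szf wE; rewrite (poly_weightE szf) /hamming_weight -sum1dep_card big_mkcond.
by apply: eq_bigr => i _; rewrite wE coef_uv_poly mul_uv_eq0; case: eqP.
Qed.

Variables (p s : nat) (a0 a1 a2 a3 a4 : F).
Hypotheses (charFp : p \in [pchar F]) (ha0 : a0 ^+ (p ^ s) = a1) (ha3 : a3 != 0).
Variable alpha : R.
Hypothesis halpha : alpha = c a1 + c a2 * u + c a3 * v + c a4 * (u * v).

Let n := (2 * p ^ s)%N.
Let M := constacyclic_modulus n alpha.
Let res := residue_class n alpha.
Let base : {poly F} := 'X^2 - a0%:P.
Let code l :=
  code_of (principal_ideal (res (u%:P * ('X^2 - (c a0)%:P) ^+ l))).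

Let p_gt0 : (0 < p)%N. Proof. exact/prime_gt0/(pcharf_prime charFp). Qed.
Let n_gt0 : (0 < n)%N. Proof. by rewrite muln_gt0 expn_gt0 p_gt0. Qed.

Lemma residue_classM f g : res (f * g) = res f * res g.
Proof. exact: in_qpolyM. Qed.

Lemma residue_classD f g : res (f + g) = res f + res g.
Proof. exact: in_qpolyD. Qed.

Lemma residue_class_modulus f : res (f * M) = 0.
Proof.
rewrite -[M](constacyclic_modulusE alpha n_gt0).
apply/val_inj => /=; apply: Pdiv.RingMonic.rmodp_mull; exact: monic_mk_monic.
Qed.

Lemma residue_class_id (z : constacyclic_ring n alpha) : res (z : {poly R}) = z.
Proof. by apply/val_inj/in_qpoly_small/size_mk_monic. Qed.

Lemma residue_class_small (f : {poly R}) :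
  (size f <= n)%N -> res f = f :> {poly R}.
Proof.
by move=> szf; apply: in_qpoly_small; rewrite constacyclic_modulusE // size_XnsubC.
Qed.

Lemma base_exp : base ^+ (p ^ s) = 'X^n - a1%:P.
Proof. by rewrite (expr_XnsubC_pchar charFp) ha0. Qed.

(** Multiplying [alpha - a1 = a2 u + a3 v + a4 uv] by [u] leaves only [a3 uv]. *)
Lemma residue_class_generator k :
  res (u%:P * ('X^2 - (c a0)%:P) ^+ (p ^ s + k))
    = res (uv_poly (a3%:P * base ^+ k)).
Proof.
rewrite exprD mulrA -map_XnsubC -!rmorphXn /= base_exp map_XnsubC.
have -> : u%:P * ('X^n - (c a1)%:P) = (c a3 * (u * v))%:P + u%:P * M.
  have E : u * alpha = c a1 * u + c a3 * (u * v) by rewrite halpha mul_u_span.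
  by rewrite !mulrBr -!polyCM E polyCD [u * c a1]mulrC; ring.
rewrite mulrDl [u%:P * M * _]mulrAC residue_classD residue_class_modulus addr0.
by rewrite uv_polyM /uv_poly map_polyC -!mul_polyC polyCM -mulrA.
Qed.

(** Since [uv * alpha = a1 * uv], the modulus times [uv] is the image of [X^n - a1], so reduction
    can be done over [F]. *)
Lemma residue_class_uv_poly_modp f :
  res (uv_poly f) = res (uv_poly (f %% ('X^n - a1%:P))).
Proof.
have uvM : uv_poly ('X^n - a1%:P) = (u * v)%:P * M.
  rewrite mul_polyC /uv_poly map_XnsubC !scalerBr; congr (_ - _).
  by rewrite -!mul_polyC -!polyCM halpha mul_uv_span mulrC.
rewrite {1}(divp_eq f ('X^n - a1%:P)) uv_polyD uv_polyM uvM mulrA residue_classD.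
by rewrite residue_class_modulus add0r.
Qed.

Lemma hamming_distance_le_exp l : (l <= p ^ s)%N -> is_hamming_distance (code l) 1.
Proof.
move=> le_l; split=> [|w _ w0]; last by rewrite lt0n hamming_weight_eq0.
have sz1 : (size (1%R : {poly F}) <= n)%N by rewrite size_poly1.
pose w : 'rV[R]_n := \row_i (uv_poly 1)`_i.
have ww : hamming_weight w = 1%N.
  rewrite (hamming_weight_uv_poly sz1) => [|i]; last by rewrite mxE.
  apply/eqP; rewrite eqn_leq poly_weight_gt0 ?oner_neq0 // andbT.
  by rewrite (leq_trans (leq_poly_weight_size _)) ?size_poly1.
exists w; split=> //; last by rewrite -hamming_weight_eq0 ww.
exists (res (uv_poly 1)).
  (* This multiplier completes the exponent to [p ^ s] and cancels [a3], leaving the constant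
     [uv]. *)
  exists (res ((c a3^-1)%:P * ('X^2 - (c a0)%:P) ^+ (p ^ s - l))).
  rewrite -residue_classM mulrACA [_ * u%:P]mulrC -mulrA -exprD subnK //.
  have := residue_class_generator 0; rewrite addn0 expr0 mulr1 => E.
  rewrite mulrCA residue_classM E -residue_classM.
  by rewrite -map_polyC -uv_polyM -polyCM mulVf.
apply/rowP => i; rewrite !mxE residue_class_small //.
by rewrite (leq_trans (size_uv_poly _)).
Qed.

(** As [k <= p ^ s], [base ^+ k] divides [base ^+ (p ^ s) = X^n - a1], so divisibility by it
    survives reduction modulo [X^n - a1]. *)
Lemma codewordP k w : (k <= p ^ s)%N ->
  code (p ^ s + k) w <->
  exists f : {poly F}, [/\ (size f <= n)%N, base ^+ k %| f
               & forall i, w 0 i = (uv_poly f)`_i].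
Proof.
move=> le_k; split=> [[_ [z ->] ->] | [f [szf /dvdpP[g fE] wE]]].
  rewrite residue_class_generator -{1}[z]residue_class_id -residue_classM.
  have [g ->] := mul_uv_poly (z : {poly R}) (a3%:P * base ^+ k).
  rewrite residue_class_uv_poly_modp; set f := _ %% _.
  have szf : (size f <= n)%N.
    have := ltn_modpN0 (g * (a3%:P * base ^+ k)) (monic_neq0 (monicXnsubC a1 n_gt0)).
    by rewrite size_XnsubC.
  exists f; split=> // [|i].
    rewrite /f -(dvdp_mod _ (_ : base ^+ k %| _)); first by rewrite mulrA dvdp_mulIr.
    by rewrite -base_exp dvdp_exp2l.
  by rewrite mxE residue_class_small // (leq_trans (size_uv_poly _)).
exists (res (uv_poly f)).
  exists (res (map_poly c (a3^-1 *: g))); rewrite residue_class_generator -residue_classM.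
  by rewrite -uv_polyM fE -scalerAl mulrCA mul_polyC scalerA mulVf // scale1r.
apply/rowP => i; rewrite wE !mxE residue_class_small //.
by rewrite (leq_trans (size_uv_poly _)).
Qed.

Lemma hamming_distance_gt_exp k b G : a0 != 0 -> (b < s)%N -> (0 < G < p)%N ->
  (p ^ s - p ^ (s - b) + (G - 1) * p ^ (s - b - 1) < k
     <= p ^ s - p ^ (s - b) + G * p ^ (s - b - 1))%N ->
  is_hamming_distance (code (p ^ s + k)) (G.+1 * p ^ b).
Proof.
move=> a0_neq0 lt_b G_range /andP[k_gt k_le].
(* The upper end of the range: [base ^+ k'] is a codeword of minimum weight for every [k] in it.
   Since [G < p], [k' < p ^ s] and this power has degree below [n]. *)
set k' := (_ + _)%N in k_le.
have lt_k' : (k' < p ^ s)%N.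
  rewrite /k'; have -> : (s - b = (s - b - 1).+1)%N by lia.
  rewrite subSS subn0 expnS; have : (p * p ^ (s - b - 1) <= p ^ s)%N.
    by rewrite -expnS leq_exp2l ?(prime_gt1 (pcharf_prime charFp)) //; lia.
  have : (0 < p ^ (s - b - 1))%N by rewrite expn_gt0 p_gt0.
  by move: (p ^ _)%N (p ^ _)%N => x y; nia.
have le_k : (k <= p ^ s)%N by rewrite (leq_trans k_le) // ltnW.
have lower w : code (p ^ s + k) w -> w != 0 -> (G.+1 * p ^ b <= hamming_weight w)%N.
  move=> /(codewordP w le_k)[f [szf dvd wE]] w0.
  rewrite (hamming_weight_uv_poly szf wE).
  apply: (poly_weight_dvd_XnsubC_exp charFp a0_neq0 lt_b G_range k_gt (n := 2)) => //.
  apply: contraNneq w0 => f0; apply/eqP/rowP => i.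
  by rewrite wE f0 coef_uv_poly coef0 rmorph0 mul0r mxE.
split=> //; pose f := base ^+ k'.
have szf : (size f <= n)%N.
  have -> : size f = (2 * k').+1.
    rewrite /f; elim: (k') => [|j IH]; first by rewrite expr0 size_poly1 muln0.
    rewrite exprS size_Mmonic ?monic_neq0 ?monic_exp ?monicXnsubC //.
    by rewrite IH size_XnsubC // mulnS.
  by rewrite ltn_mul2l.
pose w : 'rV[R]_n := \row_i (uv_poly f)`_i.
have wE i : w 0 i = (uv_poly f)`_i by rewrite mxE.
have Cw : code (p ^ s + k) w.
  by apply/(codewordP w le_k); exists f; split=> //; apply: dvdp_exp2l.
have w0 : w != 0.
  rewrite -hamming_weight_eq0 (hamming_weight_uv_poly szf wE) -lt0n.
  by rewrite poly_weight_gt0 // expf_neq0 // monic_neq0 // monicXnsubC.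
exists w; split=> //; apply/eqP; rewrite eqn_leq lower // andbT.
by rewrite (hamming_weight_uv_poly szf wE) poly_weight_XnsubC_exp.
Qed.

End FreeOverField.

(** * The concrete ring and the distance formula *)

HB.instance Definition _ (F : fieldType) :=
  GRing.RMorphism.copy (@Rc F) (qpolyC (X2 (Ru_ring F)) \o qpolyC (X2 F)).

(** The hypothesis yields two expansions of [0] in the basis [1, u, v, uv], which must agree. *)
Lemma Rc_mul_uv_eq0 (F : fieldType) (a : F) : Rc a * (Ru * Rv) = 0 -> a = 0.
Proof.
move=> E; have [x [_ uniq]] := Ruv_basis (0 : Ruv F).
have E0 : 0 = Rc 0 + Rc 0 * Ru + Rc 0 * Rv + Rc 0 * (Ru * Rv) :> Ruv F.
  by rewrite rmorph0 !mul0r !addr0.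
have Ea : 0 = Rc 0 + Rc 0 * Ru + Rc 0 * Rv + Rc a * (Ru * Rv) :> Ruv F.
  by rewrite E rmorph0 !mul0r !addr0.
have := uniq (0, 0, (0, a)) Ea; rewrite (uniq (0, 0, (0, 0)) E0) => x0.
by case: x0.
Qed.

Lemma Ruv_span (F : fieldType) (z : Ruv F) : exists a : F * F * (F * F),
  z = Rc a.1.1 + Rc a.1.2 * Ru + Rc a.2.1 * Rv + Rc a.2.2 * (Ru * Rv).
Proof. by have [a [zE _]] := Ruv_basis z; exists a. Qed.

Theorem theorem4p2 (p m s : nat) (F : finFieldType)
    (hp : prime p) (hp2 : odd p) (hm : (0 < m)%N) (hs : (0 < s)%N)
    (hF : #|F| = (p ^ m)%N)
    (a1 a2 a3 a4 : F) (ha1 : a1 != 0) (ha2 : a2 != 0) (ha3 : a3 != 0)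
    (alpha : Ruv F)
    (halpha : alpha = Rc a1 + Rc a2 * Ru + Rc a3 * Rv + Rc a4 * (Ru * Rv))
    (hsq : ~ exists beta : Ruv F, alpha = beta ^+ 2)
    (a0 : F) (ha0 : a0 ^+ (p ^ s) = a1)
    (l : nat) (hl : (l <= 2 * p ^ s - 1)%N) :
  let n := (2 * p ^ s)%N in
  let C := code_of (principal_ideal
             (residue_class n alpha (Ru%:P * ('X^2 - (Rc a0)%:P) ^+ l))) in
  ((l <= p ^ s)%N -> is_hamming_distance C 1) /\
  (forall G g : nat,
     (1 <= G <= p - 1)%N -> (g <= s - 1)%N ->
     (2 * p ^ s - p ^ (s - g) + (G - 1) * p ^ (s - g - 1) + 1 <= l
        <= 2 * p ^ s - p ^ (s - g) + G * p ^ (s - g - 1))%N ->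
     is_hamming_distance C ((G + 1) * p ^ g)).
Proof.

have charFp : p \in [pchar F] := card_finPcharP hF hp.
have ps_gt0 : (0 < p ^ s)%N by rewrite expn_gt0 prime_gt0.
move=> n C; split=> [le_l | G g G_range le_g l_range].
  exact: (hamming_distance_le_exp (Ru_sqr F) (@Rc_mul_uv_eq0 F) charFp ha0 ha3
    halpha le_l).
have a0_neq0 : a0 != 0.
  by apply: contraNneq ha1 => a00; rewrite -ha0 a00 expr0n eqn0Ngt ps_gt0.
have le_pow : (p ^ (s - g) <= p ^ s)%N by rewrite leq_exp2l ?prime_gt1 ?leq_subr.
(* By [le_pow] no subtraction truncates, so [2 p^s - p^(s-g)] is [p^s + (p^s - p^(s-g))]; the [+ 1]
   turns into a strict inequality. *)
have [le_l k_range] : (p ^ s <= l)%N /\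
    (p ^ s - p ^ (s - g) + (G - 1) * p ^ (s - g - 1) < l - p ^ s
       <= p ^ s - p ^ (s - g) + G * p ^ (s - g - 1))%N.
  move: l_range le_pow; move: (p ^ s)%N (p ^ (s - g))%N ((G - 1) * _)%N (G * _)%N.
  by move=> x y z t; lia.
rewrite addn1 /C -(subnKC le_l).
apply: (hamming_distance_gt_exp (Ru_sqr F) (Rv_sqr F) (@Ruv_span F)
  (@Rc_mul_uv_eq0 F) charFp ha0 ha3 halpha a0_neq0) k_range; lia.
Qed.
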